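(* An admissible process $\pi=(u_i,\theta,\varphi,e_{ij},\kappa_{ijk},\beta_i,E_i,V_{ij},\tau_{ij},\mu_{ijk},\sigma_i,Q_{ji},\eta,q_i)$ is a solution of the mixed initial-boundary value problem $\Pi$ if and only if it satisfies the geometric equations $$e_{ij}=\tfrac12(u_{i,j}+u_{j,i}),\quad \kappa_{ijk}=u_{k,ij},\quad \beta_i=\theta_{,i},\quad E_i=-\varphi_{,i},\quad V_{ij}=-\varphi_{,ij},$$ the equations $$\begin{aligned} &\xi*(\tau_{ji,j}-\mu_{kji,kj})-\rho u_i+\mathcal F_i=0,\\ &\xi*(\sigma_{i,i}-Q_{ji,ji}-g)=0,\\ &\rho T_0\eta+l*q_{i,i}-\mathcal H=0,\\ &\zeta*(\tau_{ij}-\hat\tau_{ij})-a^{(14)}_{ij}\theta+\mathcal L_{ij}=0,\\ &\zeta*(\mu_{ijk}-\hat\mu_{ijk})=0,\\ &-\zeta*(\sigma_i-\hat\sigma_i)=0,\\ &-\zeta*(Q_{ij}-\hat Q_{ij})-a^{(47)}_{ij}\theta+\mathcal M_{ij}=0,\\ &-\chi*(\rho\eta-\rho\hat\eta)-c\theta+\mathcal R=0,\\ &-\tfrac{1}{T_0}\,l*(q_i-\hat q_i)=0, \end{aligned}$$ and the boundary conditions of $\Pi$ (where the constitutive coefficients are subject to the restriction $\gamma/\beta\ge0$, $k_{ij}\eta_i\eta_j\ge0$ for all $\eta_i$).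
   Context: Conventions: Latin subscripts range over $1,2,3$; repeated subscripts are summed; $_{,i}$ denotes $\partial/\partial x_i$; a superposed dot denotes $\partial/\partial t$; $I=[0,\infty)$; dependence on $x$ is suppressed. $B$ is a bounded region (connected open set) of three-dimensional Euclidean space with smooth boundary $\partial B$ and outward unit normal $n_i$. Constants (homogeneous, center-symmetric material): $\rho>0$, $T_0>0$, $\beta\neq0$, $c\neq0$, $\gamma$, $\beta'=\beta+\gamma/(c\beta)\neq0$, and coefficients with the symmetries $a^{(11)}_{ijkl}=a^{(11)}_{jikl}=a^{(11)}_{klij}$, $a^{(14)}_{ij}=a^{(14)}_{ji}$, $a^{(22)}_{ijklhm}=a^{(22)}_{jiklhm}=a^{(22)}_{lhmijk}$, $a^{(23)}_{ijkl}=a^{(23)}_{jikl}$, $a^{(33)}_{ij}=a^{(33)}_{ji}$, $k_{ij}=k_{ji}$, $a^{(17)}_{ijkl}=a^{(17)}_{jikl}$, $a^{(77)}_{ijkl}=a^{(77)}_{jikl}=a^{(77)}_{klij}$, $a^{(47)}_{ij}=a^{(47)}_{ji}$. It is assumed that $\gamma/\beta\ge0$ and $k_{ij}\eta_i\eta_j\ge0$ for all vectors $\eta_i$. An admissible process is an ordered array $\pi=(u_i,\theta,\varphi,e_{ij},\kappa_{ijk},\beta_i,E_i,V_{ij},\tau_{ij},\mu_{ijk},\sigma_i,Q_{ji},\eta,q_i)$ of functions on $\bar B\times I$ with $u_i\in C^{4,2}$, $\varphi\in C^{4,0}$, $\theta\in C^{2,2}$, $e_{ij},V_{ij}\in C^{2,1}$,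 $\eta\in C^{0,1}$, $\kappa_{ijk},E_i,\mu_{ijk},Q_{ij}\in C^{2,0}$, $\beta_i,\tau_{ij},\sigma_i,q_i\in C^{1,0}$ (all on $\bar B\times I$), and $e_{ij}=e_{ji}$, $\kappa_{ijk}=\kappa_{jik}$, $V_{ij}=V_{ji}$, $\tau_{ij}=\tau_{ji}$, $\mu_{kji}=\mu_{jki}$, $Q_{ij}=Q_{ji}$. Here $C^{M,N}$ means continuous together with partial derivatives of order up to $M$ in $x$ and up to $N$ in $t$. Problem $\Pi$. The data $f_i,g,h,u_i^0,v_i^0,\theta^0,\eta^0,\hat u_i,\hat d_i,\hat\theta,\hat\varphi,\hat\omega,\hat P_i,\hat R_i,\hat q,\hat\Lambda,\hat H$ are prescribed continuous functions. A solution of $\Pi$ is an admissible process satisfying: (1) balance equations: $\tau_{ji,j}-\mu_{kji,kj}+\rho f_i=\rho\ddot u_i$, $\ \sigma_{i,i}-Q_{ji,ji}=g$, $\ \rho T_0\dot\eta+q_{j,j}-\rho h=0$; (2) geometric equations: $e_{ij}=\frac12(u_{i,j}+u_{j,i})$, $\kappa_{ijk}=u_{k,ij}$, $\beta_i=\theta_{,i}$, $E_i=-\varphi_{,i}$, $V_{ij}=-\varphi_{,ij}$; (3) constitutive equations: $\tau_{ij}=a^{(11)}_{ijkl}e_{kl}+a^{(17)}_{ijkl}V_{kl}+a^{(14)}_{ij}(\theta+\beta\dot\theta)$, $\ \mu_{ijk}=a^{(22)}_{ijklhm}\kappa_{lhm}+a^{(23)}_{ijkl}E_l$, $\ -\sigma_i=a^{(23)}_{jkli}\kappa_{jkl}+a^{(33)}_{ij}E_j$,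 $\ -Q_{ij}=a^{(17)}_{klij}e_{kl}+a^{(77)}_{ijkl}V_{kl}+a^{(47)}_{ij}(\theta+\beta\dot\theta)$, $\ -\rho\eta=a^{(14)}_{ij}e_{ij}+a^{(47)}_{ij}V_{ij}+c(\theta+\beta'\dot\theta)$, $\ -\frac1{T_0}q_i=k_{ij}\beta_j$; (4) initial conditions in $\bar B$: $u_i(0)=u_i^0$, $\dot u_i(0)=v_i^0$, $\theta(0)=\theta^0$, $\eta(0)=\eta^0$; (5) boundary conditions: $u_i=\hat u_i$ on $S_1\times I$, $P_i=\hat P_i$ on $\Sigma_1\times I$; $\mathcal Du_i=\hat d_i$ on $S_2\times I$, $R_i=\hat R_i$ on $\Sigma_2\times I$; $\theta=\hat\theta$ on $S_3\times I$, $q=\hat q$ on $\Sigma_3\times I$; $\varphi=\hat\varphi$ on $S_4\times I$, $\Lambda=\hat\Lambda$ on $\Sigma_4\times I$; $\mathcal D\varphi=\hat\omega$ on $S_5\times I$, $H=\hat H$ on $\Sigma_5\times I$. Here $S_i,\Sigma_i\subset\partial B$ with $\bar S_i\cup\Sigma_i=\partial B$ (closure relative to $\partial B$), $S_i\cap\Sigma_i=\varnothing$, $i=1,\dots,5$; $\mathcal D=n_i\partial/\partial x_i$, $\mathcal D_i=(\delta_{ij}-n_in_j)\partial/\partial x_j$; $q=q_in_i$; $P_i=(\tau_{ji}-\mu_{kji,k})n_j-\mathcal D_j(\mu_{kji}n_k)+(\mathcal D_ln_l)\mu_{kji}n_kn_j$; $\Lambda=(\sigma_j-Q_{kj,k})n_j-\mathcal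 D_j(Q_{kj}n_k)+(\mathcal D_ln_l)Q_{kj}n_kn_j$; $R_i=\mu_{kji}n_kn_j$; $H=Q_{kj}n_kn_j$. Convolution: $[f_1*f_2](t)=\int_0^t f_1(\tau)f_2(t-\tau)\,d\tau$, $t\in I$. Also $l(t)=1$, $\xi(t)=[l*l](t)=t$, $\zeta(t)=\frac1\beta e^{-t/\beta}$, $\chi(t)=\frac1{\beta'}e^{-t/\beta'}$. Abbreviations: $\hat\tau_{ij}=a^{(11)}_{ijkl}e_{kl}+a^{(17)}_{ijkl}V_{kl}$, $\hat\mu_{ijk}=a^{(22)}_{ijklhm}\kappa_{lhm}+a^{(23)}_{ijkl}E_l$, $-\hat\sigma_i=a^{(23)}_{jkli}\kappa_{jkl}+a^{(33)}_{ij}E_j$, $-\hat Q_{ij}=a^{(17)}_{klij}e_{kl}+a^{(77)}_{ijkl}V_{kl}$, $-\rho\hat\eta=a^{(14)}_{ij}e_{ij}+a^{(47)}_{ij}V_{ij}$, $-\hat q_i=T_0k_{ij}\beta_j$ (without hat meaning of boundary data); and $\mathcal F_i=\rho\,\xi*f_i+\rho v_i^0t+\rho u_i^0$, $\mathcal H=\rho T_0\eta^0+l*\rho h$, $\mathcal L_{ij}=a^{(14)}_{ij}\theta^0e^{-t/\beta}$, $\mathcal M_{ij}=a^{(47)}_{ij}\theta^0e^{-t/\beta}$, $\mathcal R=c\,\theta^0e^{-t/\beta'}$. *)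

(* Defs.v *)
From HB Require Import structures.
From mathcomp Require Import all_boot all_order all_algebra.
From mathcomp Require Import all_classical all_reals all_analysis.

Set Implicit Arguments.
Unset Strict Implicit.
Unset Printing Implicit Defensive.

Import Order.TTheory GRing.Theory Num.Theory.
Import numFieldNormedType.Exports.

Local Open Scope classical_set_scope.
Local Open Scope ring_scope.

(* Three-dimensional Euclidean space.  The norm `|_| of 'rV[R]_3 is the sup norm,
   which induces the same topology; enorm below is the Euclidean norm. *)
Notation E3 R := 'rV[R]_3.

(* A function on cl(B) x [0, oo[ is represented by a total function whose values
   outside cl(B) x [0, oo[ are never used. *)
Notation stfield R := (E3 R -> R -> R).

Definition timeI (R : realType) : set R := `[0, +oo[%classic.

Definition evec (R : realType) (i : 'I_3) : E3 R := delta_mx 0 i.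

Definition bdry (R : realType) (B : set (E3 R)) : set (E3 R) :=
  closure B `\` interior B.

Definition grad (R : realType) (F : E3 R -> R) (x : E3 R) : E3 R :=
  \row_i 'D_(evec R i) F x.

Definition enorm (R : realType) (v : E3 R) : R :=
  Num.sqrt (\sum_i v 0 i ^+ 2).

(* C^oo on the open set U: the iterated partial derivatives
   d_{s_1} (d_{s_2} (... F)) of all orders exist and are continuous on U. *)
Definition smooth_on (R : realType) (U : set (E3 R)) (F : E3 R -> R) :=
  forall (s : seq 'I_3) (x : E3 R), U x ->
    let G := foldr (fun i K => 'D_(evec R i) K) F s in
    {for x, continuous G} /\ forall i, derivable G x (evec R i).

(* Near x, B is the sublevel set {Phi < 0} of a smooth function without
   critical points. *)
Definition defining_function (R : realType) (B : set (E3 R)) (x : E3 R)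
    (U : set (E3 R)) (Phi : E3 R -> R) :=
  [/\ open U, U x, smooth_on U Phi, forall y, U y -> grad Phi y != 0
    & forall y, U y -> (B y <-> Phi y < 0)].

Definition smooth_boundary (R : realType) (B : set (E3 R)) :=
  forall x, bdry B x -> exists U Phi, defining_function B x U Phi.

Definition bounded_smooth_region (R : realType) (B : set (E3 R)) :=
  [/\ open B, connected B, B !=set0, bounded_set B & smooth_boundary B].

(* On the boundary n is the outward unit normal.  Differentiating n_i requires
   values off the boundary: n is extended smoothly to a neighbourhood W of it.
   The only derivatives taken of n are the tangential ones, surfD below, whose
   values on the boundary do not depend on the extension. *)
Definition outward_unit_normal (R : realType) (B : set (E3 R))
    (n : E3 R -> E3 R) :=
  (exists W : set (E3 R), [/\ open W, bdry B `<=` W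
     & forall i, smooth_on W (fun y => n y 0 i)]) /\
  forall x, bdry B x -> exists U Phi, defining_function B x U Phi /\
    n x = (enorm (grad Phi x))^-1 *: grad Phi x.

(* S k and Sigma k are the sets S_k and Sigma_k for k = 1, ..., 5; other values
   of k are not used.  As bdry B is closed, the closure of S k relative to it is
   the ordinary closure intersected with it. *)
Definition boundary_partition (R : realType) (B : set (E3 R))
    (S Sigma : nat -> set (E3 R)) :=
  forall k, (1 <= k <= 5)%N ->
    [/\ S k `<=` bdry B, Sigma k `<=` bdry B,
        (closure (S k) `&` bdry B) `|` Sigma k = bdry B
      & S k `&` Sigma k = set0].

(* Partial derivative in B; on the boundary of B, the limit of its values in
   B, i.e. its extension by continuity to cl(B). *)
Definition dx (R : realType) (B : set (E3 R)) (i : 'I_3) (F : stfield R) :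
    stfield R := fun x t =>
  if x \in B then 'D_(evec R i) (F^~ t) x
  else lim ('D_(evec R i) (F^~ t) @ within B (nbhs x)).

(* Difference quotients with t + h in [0, oo[: two-sided derivative for t > 0,
   right derivative for t = 0. *)
Definition dt_quotients (R : realType) (F : stfield R) (x : E3 R) (t : R) :=
  (fun h => h^-1 * (F x (t + h) - F x t))
    @ within [set h | timeI (t + h)] (0^').

Definition dt (R : realType) (F : stfield R) : stfield R :=
  fun x t => lim (dt_quotients F x t).

Definition derivable_t (R : realType) (F : stfield R) (x : E3 R) (t : R) :=
  cvg (dt_quotients F x t).

Definition continuous_on (R : realType) (D : set (E3 R)) (F : stfield R) :=
  {within D `*` @timeI R, continuous (fun z : E3 R * R => F z.1 z.2)}.

(* C^{M,N}: the derivatives of order at most M in x of the time derivatives of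
   order at most N exist and are continuous on cl(B) x [0, oo[.  Continuity of
   [dx B i G] at boundary points asserts that the derivative, taken in B,
   extends continuously to cl(B). *)
Definition classC (R : realType) (B : set (E3 R)) (M N : nat)
    (F : stfield R) :=
  [/\ forall k x t, (k < N)%N -> closure B x -> timeI t ->
        derivable_t (iter k (@dt R) F) x t,
      forall (s : seq 'I_3) k i x t, (size s < M)%N -> (k <= N)%N ->
        B x -> timeI t ->
        derivable (fun y => foldr (dx B) (iter k (@dt R) F) s y t)
                  x (evec R i)
    & forall (s : seq 'I_3) k, (size s <= M)%N -> (k <= N)%N ->
        continuous_on (closure B) (foldr (dx B) (iter k (@dt R) F) s)].

Record material (R : realType) := Material {
  rho : R; T0 : R; beta : R; cth : R; gamma : R;
  a11 : 'I_3 -> 'I_3 -> 'I_3 -> 'I_3 -> R;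
  a14 : 'I_3 -> 'I_3 -> R;
  a17 : 'I_3 -> 'I_3 -> 'I_3 -> 'I_3 -> R;
  a22 : 'I_3 -> 'I_3 -> 'I_3 -> 'I_3 -> 'I_3 -> 'I_3 -> R;
  a23 : 'I_3 -> 'I_3 -> 'I_3 -> 'I_3 -> R;
  a33 : 'I_3 -> 'I_3 -> R;
  a47 : 'I_3 -> 'I_3 -> R;
  a77 : 'I_3 -> 'I_3 -> 'I_3 -> 'I_3 -> R;
  kth : 'I_3 -> 'I_3 -> R }.

Definition beta' (R : realType) (m : material R) : R :=
  m.(beta) + m.(gamma) / (m.(cth) * m.(beta)).

Record material_symmetries (R : realType) (m : material R) : Prop := {
  a11_symm : forall i j k l, m.(a11) i j k l = m.(a11) j i k l
                          /\ m.(a11) i j k l = m.(a11) k l i j;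
  a14_symm : forall i j, m.(a14) i j = m.(a14) j i;
  a22_symm : forall i j k l h r,
    m.(a22) i j k l h r = m.(a22) j i k l h r /\
    m.(a22) i j k l h r = m.(a22) l h r i j k;
  a23_symm : forall i j k l, m.(a23) i j k l = m.(a23) j i k l;
  a33_symm : forall i j, m.(a33) i j = m.(a33) j i;
  kth_symm : forall i j, m.(kth) i j = m.(kth) j i;
  a17_symm : forall i j k l, m.(a17) i j k l = m.(a17) j i k l;
  a77_symm : forall i j k l, m.(a77) i j k l = m.(a77) j i k l
                          /\ m.(a77) i j k l = m.(a77) k l i j;
  a47_symm : forall i j, m.(a47) i j = m.(a47) j i }.

Record material_assumptions (R : realType) (m : material R) : Prop := {
  rho_pos : 0 < m.(rho);
  T0_pos : 0 < m.(T0);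
  beta_neq0 : m.(beta) != 0;
  cth_neq0 : m.(cth) != 0;
  beta'_neq0 : beta' m != 0;
  symmetries : material_symmetries m;
  gamma_beta_ge0 : 0 <= m.(gamma) / m.(beta);
  kth_psd : forall w : 'I_3 -> R,
    0 <= \sum_i \sum_j m.(kth) i j * w i * w j }.

Record data (R : realType) := Data {
  f : 'I_3 -> stfield R; g : stfield R; h : stfield R;
  u0 : 'I_3 -> E3 R -> R; v0 : 'I_3 -> E3 R -> R;
  theta0 : E3 R -> R; eta0 : E3 R -> R;
  uhat : 'I_3 -> stfield R; dhat : 'I_3 -> stfield R;
  thetahat : stfield R; phihat : stfield R; omegahat : stfield R;
  Phat : 'I_3 -> stfield R; Rhat : 'I_3 -> stfield R;
  qhat : stfield R; Lambdahat : stfield R; Hhat : stfield R }.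

Record continuous_data (R : realType) (B : set (E3 R))
    (S Sigma : nat -> set (E3 R)) (d : data R) : Prop := {
  f_cont : forall i, continuous_on (closure B) (d.(f) i);
  g_cont : continuous_on (closure B) d.(g);
  h_cont : continuous_on (closure B) d.(h);
  u0_cont : forall i, {within closure B, continuous (d.(u0) i)};
  v0_cont : forall i, {within closure B, continuous (d.(v0) i)};
  theta0_cont : {within closure B, continuous d.(theta0)};
  eta0_cont : {within closure B, continuous d.(eta0)};
  uhat_cont : forall i, continuous_on (S 1%N) (d.(uhat) i);
  dhat_cont : forall i, continuous_on (S 2%N) (d.(dhat) i);
  thetahat_cont : continuous_on (S 3%N) d.(thetahat);
  phihat_cont : continuous_on (S 4%N) d.(phihat);
  omegahat_cont : continuous_on (S 5%N) d.(omegahat);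
  Phat_cont : forall i, continuous_on (Sigma 1%N) (d.(Phat) i);
  Rhat_cont : forall i, continuous_on (Sigma 2%N) (d.(Rhat) i);
  qhat_cont : continuous_on (Sigma 3%N) d.(qhat);
  Lambdahat_cont : continuous_on (Sigma 4%N) d.(Lambdahat);
  Hhat_cont : continuous_on (Sigma 5%N) d.(Hhat) }.

(* betav is the thermal-gradient field beta_i, as opposed to the constant beta
   of the material. *)
Record process (R : realType) := Process {
  u : 'I_3 -> stfield R;
  theta : stfield R;
  phi : stfield R;
  e : 'I_3 -> 'I_3 -> stfield R;
  kappa : 'I_3 -> 'I_3 -> 'I_3 -> stfield R;
  betav : 'I_3 -> stfield R;
  E : 'I_3 -> stfield R;
  V : 'I_3 -> 'I_3 -> stfield R;
  tau : 'I_3 -> 'I_3 -> stfield R;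
  mu : 'I_3 -> 'I_3 -> 'I_3 -> stfield R;
  sigma : 'I_3 -> stfield R;
  Q : 'I_3 -> 'I_3 -> stfield R;
  eta : stfield R;
  q : 'I_3 -> stfield R }.

Record admissible_regularity (R : realType) (B : set (E3 R))
    (p : process R) : Prop := {
  u_reg : forall i, classC B 4 2 (p.(u) i);
  phi_reg : classC B 4 0 p.(phi);
  theta_reg : classC B 2 2 p.(theta);
  e_reg : forall i j, classC B 2 1 (p.(e) i j);
  V_reg : forall i j, classC B 2 1 (p.(V) i j);
  eta_reg : classC B 0 1 p.(eta);
  kappa_reg : forall i j k, classC B 2 0 (p.(kappa) i j k);
  E_reg : forall i, classC B 2 0 (p.(E) i);
  mu_reg : forall i j k, classC B 2 0 (p.(mu) i j k);
  Q_reg : forall i j, classC B 2 0 (p.(Q) i j);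
  betav_reg : forall i, classC B 1 0 (p.(betav) i);
  tau_reg : forall i j, classC B 1 0 (p.(tau) i j);
  sigma_reg : forall i, classC B 1 0 (p.(sigma) i);
  q_reg : forall i, classC B 1 0 (p.(q) i) }.

Record admissible_symmetry (R : realType) (B : set (E3 R))
    (p : process R) : Prop := {
  e_symm : forall i j x t, closure B x -> timeI t ->
    p.(e) i j x t = p.(e) j i x t;
  kappa_symm : forall i j k x t, closure B x -> timeI t ->
    p.(kappa) i j k x t = p.(kappa) j i k x t;
  V_symm : forall i j x t, closure B x -> timeI t ->
    p.(V) i j x t = p.(V) j i x t;
  tau_symm : forall i j x t, closure B x -> timeI t ->
    p.(tau) i j x t = p.(tau) j i x t;
  mu_symm : forall k j i x t, closure B x -> timeI t ->
    p.(mu) k j i x t = p.(mu) j k i x t;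
  Q_symm : forall i j x t, closure B x -> timeI t ->
    p.(Q) i j x t = p.(Q) j i x t }.

Definition admissible (R : realType) (B : set (E3 R)) (p : process R) :=
  admissible_regularity B p /\ admissible_symmetry B p.

(* tau_{ji,j} - mu_{kji,kj} *)
Definition stress_div (R : realType) (B : set (E3 R)) (p : process R)
    (i : 'I_3) : stfield R := fun x t =>
  \sum_j dx B j (p.(tau) j i) x t
  - \sum_k \sum_j dx B j (dx B k (p.(mu) k j i)) x t.

(* sigma_{i,i} - Q_{ji,ji} *)
Definition electric_div (R : realType) (B : set (E3 R)) (p : process R) :
    stfield R := fun x t =>
  \sum_i dx B i (p.(sigma) i) x t
  - \sum_j \sum_i dx B i (dx B j (p.(Q) j i)) x t.

(* q_{i,i} *)
Definition heat_div (R : realType) (B : set (E3 R)) (p : process R) :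
    stfield R := fun x t => \sum_i dx B i (p.(q) i) x t.

Definition balance_equations (R : realType) (B : set (E3 R))
    (m : material R) (d : data R) (p : process R) : Prop :=
  forall x t, closure B x -> timeI t ->
  [/\ forall i, stress_div B p i x t + m.(rho) * d.(f) i x t
        = m.(rho) * dt (dt (p.(u) i)) x t,
      electric_div B p x t = d.(g) x t
    & m.(rho) * m.(T0) * dt p.(eta) x t + heat_div B p x t
        - m.(rho) * d.(h) x t = 0].

Definition geometric_equations (R : realType) (B : set (E3 R))
    (p : process R) : Prop :=
  forall x t, closure B x -> timeI t ->
  [/\ forall i j, p.(e) i j x t
        = 2^-1 * (dx B j (p.(u) i) x t + dx B i (p.(u) j) x t),
      forall i j k, p.(kappa) i j k x t = dx B j (dx B i (p.(u) k)) x t,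
      forall i, p.(betav) i x t = dx B i p.(theta) x t,
      forall i, p.(E) i x t = - dx B i p.(phi) x t
    & forall i j, p.(V) i j x t = - dx B j (dx B i p.(phi)) x t].

Definition constitutive_equations (R : realType) (B : set (E3 R))
    (m : material R) (p : process R) : Prop :=
  forall x t, closure B x -> timeI t ->
  let thb := p.(theta) x t + m.(beta) * dt p.(theta) x t in
  let thb' := p.(theta) x t + beta' m * dt p.(theta) x t in
  [/\ [/\ forall i j, p.(tau) i j x t =
            \sum_k \sum_l m.(a11) i j k l * p.(e) k l x t
            + \sum_k \sum_l m.(a17) i j k l * p.(V) k l x t
            + m.(a14) i j * thb,
          forall i j k, p.(mu) i j k x t =
            \sum_l \sum_h \sum_r m.(a22) i j k l h r * p.(kappa) l h r x t
            + \sum_l m.(a23) i j k l * p.(E) l x t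
        & forall i, - p.(sigma) i x t =
            \sum_j \sum_k \sum_l m.(a23) j k l i * p.(kappa) j k l x t
            + \sum_j m.(a33) i j * p.(E) j x t],
      forall i j, - p.(Q) i j x t =
        \sum_k \sum_l m.(a17) k l i j * p.(e) k l x t
        + \sum_k \sum_l m.(a77) i j k l * p.(V) k l x t
        + m.(a47) i j * thb,
      - (m.(rho) * p.(eta) x t) =
        \sum_i \sum_j m.(a14) i j * p.(e) i j x t
        + \sum_i \sum_j m.(a47) i j * p.(V) i j x t
        + m.(cth) * thb'
    & forall i, - (m.(T0)^-1 * p.(q) i x t) =
        \sum_j m.(kth) i j * p.(betav) j x t].

Definition initial_conditions (R : realType) (B : set (E3 R))
    (d : data R) (p : process R) : Prop :=
  forall x, closure B x ->
  [/\ forall i, p.(u) i x 0 = d.(u0) i x,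
      forall i, dt (p.(u) i) x 0 = d.(v0) i x,
      p.(theta) x 0 = d.(theta0) x
    & p.(eta) x 0 = d.(eta0) x].

Definition normD (R : realType) (B : set (E3 R)) (n : E3 R -> E3 R)
    (F : stfield R) : stfield R := fun x t => \sum_i n x 0 i * dx B i F x t.

Definition surfD (R : realType) (B : set (E3 R)) (n : E3 R -> E3 R)
    (i : 'I_3) (F : stfield R) : stfield R := fun x t =>
  \sum_j ((i == j)%:R - n x 0 i * n x 0 j) * dx B j F x t.

Definition surf_div_normal (R : realType) (B : set (E3 R))
    (n : E3 R -> E3 R) : stfield R := fun x t =>
  \sum_l surfD B n l (fun y _ => n y 0 l) x t.

Definition tractionP (R : realType) (B : set (E3 R))
    (n : E3 R -> E3 R) (p : process R) (i : 'I_3) : stfield R :=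
  fun x t =>
  \sum_j (p.(tau) j i x t - \sum_k dx B k (p.(mu) k j i) x t) * n x 0 j
  - \sum_j \sum_k surfD B n j (fun y s => p.(mu) k j i y s * n y 0 k) x t
  + surf_div_normal B n x t
    * (\sum_k \sum_j p.(mu) k j i x t * n x 0 k * n x 0 j).

Definition tractionR (R : realType) (n : E3 R -> E3 R) (p : process R)
    (i : 'I_3) : stfield R := fun x t =>
  \sum_k \sum_j p.(mu) k j i x t * n x 0 k * n x 0 j.

Definition surfaceLambda (R : realType) (B : set (E3 R))
    (n : E3 R -> E3 R) (p : process R) : stfield R := fun x t =>
  \sum_j (p.(sigma) j x t - \sum_k dx B k (p.(Q) k j) x t) * n x 0 j
  - \sum_j \sum_k surfD B n j (fun y s => p.(Q) k j y s * n y 0 k) x t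
  + surf_div_normal B n x t
    * (\sum_k \sum_j p.(Q) k j x t * n x 0 k * n x 0 j).

Definition surfaceH (R : realType) (n : E3 R -> E3 R) (p : process R) :
    stfield R := fun x t =>
  \sum_k \sum_j p.(Q) k j x t * n x 0 k * n x 0 j.

Definition heat_flux (R : realType) (n : E3 R -> E3 R) (p : process R) :
    stfield R := fun x t => \sum_i p.(q) i x t * n x 0 i.

Definition agree_on (R : realType) (D : set (E3 R)) (F G : stfield R) : Prop :=
  forall x t, D x -> timeI t -> F x t = G x t.

Record boundary_conditions (R : realType) (B : set (E3 R))
    (n : E3 R -> E3 R) (S Sigma : nat -> set (E3 R))
    (d : data R) (p : process R) : Prop := {
  bc_S1 : forall i, agree_on (S 1%N) (p.(u) i) (d.(uhat) i);
  bc_Sigma1 : forall i, agree_on (Sigma 1%N) (tractionP B n p i) (d.(Phat) i);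
  bc_S2 : forall i, agree_on (S 2%N) (normD B n (p.(u) i)) (d.(dhat) i);
  bc_Sigma2 : forall i, agree_on (Sigma 2%N) (tractionR n p i) (d.(Rhat) i);
  bc_S3 : agree_on (S 3%N) p.(theta) d.(thetahat);
  bc_Sigma3 : agree_on (Sigma 3%N) (heat_flux n p) d.(qhat);
  bc_S4 : agree_on (S 4%N) p.(phi) d.(phihat);
  bc_Sigma4 : agree_on (Sigma 4%N) (surfaceLambda B n p) d.(Lambdahat);
  bc_S5 : agree_on (S 5%N) (normD B n p.(phi)) d.(omegahat);
  bc_Sigma5 : agree_on (Sigma 5%N) (surfaceH n p) d.(Hhat) }.

Record solution (R : realType) (B : set (E3 R)) (n : E3 R -> E3 R)
    (S Sigma : nat -> set (E3 R)) (m : material R) (d : data R)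
    (p : process R) : Prop := {
  sol_admissible : admissible B p;
  sol_balance : balance_equations B m d p;
  sol_geometric : geometric_equations B p;
  sol_constitutive : constitutive_equations B m p;
  sol_initial : initial_conditions B d p;
  sol_boundary : boundary_conditions B n S Sigma d p }.

Definition convol (R : realType) (f1 f2 : R -> R) (t : R) : R :=
  \int[lebesgue_measure]_(s in `[0, t]) (f1 s * f2 (t - s)).

Definition ell (R : realType) : R -> R := fun _ => 1.
Definition xi (R : realType) : R -> R := convol (@ell R) (@ell R).
Definition zeta (R : realType) (m : material R) : R -> R :=
  fun t => m.(beta)^-1 * expR (- t / m.(beta)).
Definition chi (R : realType) (m : material R) : R -> R :=
  fun t => (beta' m)^-1 * expR (- t / beta' m).

Definition tau_hat (R : realType) (m : material R) (p : process R)
    (i j : 'I_3) : stfield R := fun x t =>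
  \sum_k \sum_l m.(a11) i j k l * p.(e) k l x t
  + \sum_k \sum_l m.(a17) i j k l * p.(V) k l x t.

Definition mu_hat (R : realType) (m : material R) (p : process R)
    (i j k : 'I_3) : stfield R := fun x t =>
  \sum_l \sum_h \sum_r m.(a22) i j k l h r * p.(kappa) l h r x t
  + \sum_l m.(a23) i j k l * p.(E) l x t.

Definition sigma_hat (R : realType) (m : material R) (p : process R)
    (i : 'I_3) : stfield R := fun x t =>
  - (\sum_j \sum_k \sum_l m.(a23) j k l i * p.(kappa) j k l x t
     + \sum_j m.(a33) i j * p.(E) j x t).

Definition Q_hat (R : realType) (m : material R) (p : process R)
    (i j : 'I_3) : stfield R := fun x t =>
  - (\sum_k \sum_l m.(a17) k l i j * p.(e) k l x t
     + \sum_k \sum_l m.(a77) i j k l * p.(V) k l x t).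

Definition eta_hat (R : realType) (m : material R) (p : process R) : stfield R :=
  fun x t =>
  - m.(rho)^-1 * (\sum_i \sum_j m.(a14) i j * p.(e) i j x t
                  + \sum_i \sum_j m.(a47) i j * p.(V) i j x t).

Definition q_hat (R : realType) (m : material R) (p : process R)
    (i : 'I_3) : stfield R := fun x t =>
  - (m.(T0) * (\sum_j m.(kth) i j * p.(betav) j x t)).

Definition calF (R : realType) (m : material R) (d : data R) (i : 'I_3) :
    stfield R := fun x t =>
  m.(rho) * convol (@xi R) (d.(f) i x) t
  + m.(rho) * d.(v0) i x * t + m.(rho) * d.(u0) i x.

Definition calH (R : realType) (m : material R) (d : data R) : stfield R :=
  fun x t => m.(rho) * m.(T0) * d.(eta0) x
    + convol (@ell R) (fun s => m.(rho) * d.(h) x s) t.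

Definition calL (R : realType) (m : material R) (d : data R) (i j : 'I_3) :
    stfield R := fun x t =>
  m.(a14) i j * d.(theta0) x * expR (- t / m.(beta)).

Definition calM (R : realType) (m : material R) (d : data R) (i j : 'I_3) :
    stfield R := fun x t =>
  m.(a47) i j * d.(theta0) x * expR (- t / m.(beta)).

Definition calR (R : realType) (m : material R) (d : data R) : stfield R :=
  fun x t => m.(cth) * d.(theta0) x * expR (- t / beta' m).

Record convolution_equations (R : realType) (B : set (E3 R))
    (m : material R) (d : data R) (p : process R) : Prop := {
  conv_momentum : forall x t, closure B x -> timeI t -> forall i,
    convol (@xi R) (stress_div B p i x) t
    - m.(rho) * p.(u) i x t + calF m d i x t = 0;
  conv_electric : forall x t, closure B x -> timeI t ->
    convol (@xi R) (fun s => electric_div B p x s - d.(g) x s) t = 0;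
  conv_energy : forall x t, closure B x -> timeI t ->
    m.(rho) * m.(T0) * p.(eta) x t + convol (@ell R) (heat_div B p x) t
    - calH m d x t = 0;
  conv_tau : forall x t, closure B x -> timeI t -> forall i j,
    convol (zeta m) (fun s => p.(tau) i j x s - tau_hat m p i j x s) t
    - m.(a14) i j * p.(theta) x t + calL m d i j x t = 0;
  conv_mu : forall x t, closure B x -> timeI t -> forall i j k,
    convol (zeta m) (fun s => p.(mu) i j k x s - mu_hat m p i j k x s) t = 0;
  conv_sigma : forall x t, closure B x -> timeI t -> forall i,
    - convol (zeta m) (fun s => p.(sigma) i x s - sigma_hat m p i x s) t = 0;
  conv_Q : forall x t, closure B x -> timeI t -> forall i j,
    - convol (zeta m) (fun s => p.(Q) i j x s - Q_hat m p i j x s) t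
    - m.(a47) i j * p.(theta) x t + calM m d i j x t = 0;
  conv_eta : forall x t, closure B x -> timeI t ->
    - convol (chi m)
        (fun s => m.(rho) * p.(eta) x s - m.(rho) * eta_hat m p x s) t
    - m.(cth) * p.(theta) x t + calR m d x t = 0;
  conv_q : forall x t, closure B x -> timeI t -> forall i,
    - (m.(T0)^-1
       * convol (@ell R) (fun s => p.(q) i x s - q_hat m p i x s) t) = 0 }.

(* Main.v *)
(* Fix x in cl(B); all equations are then equations between functions of t >= 0.
   Two such functions with derivatives F' and G' coincide iff F' = G' and
   F 0 = G 0.  The functions l * f and xi * f are the first and second iterated
   primitives of f vanishing at 0, and with the kernel b^-1 exp(-t/b) one gets
   b^-1 exp(-t/b) K(t), where K' = exp(t/b) f and K 0 = 0.  So differentiating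
   once or twice turns each convolution equation into the balance or constitutive
   equation, the lost values at t = 0 being exactly the initial conditions. *)
Require Import Defs.
From mathcomp Require Import all_boot all_order all_algebra.
From mathcomp Require Import all_classical all_reals all_analysis.
From mathcomp Require Import ring lra.

Set Implicit Arguments.
Unset Strict Implicit.
Unset Printing Implicit Defensive.
Import Order.TTheory GRing.Theory Num.Theory.
Import numFieldNormedType.Exports.
Local Open Scope classical_set_scope.
Local Open Scope ring_scope.

Section HalfLine.
Variable R : realType.
Implicit Types (f g F G : R -> R) (t s : R).

(* Continuity on [0, oo[, expressed by that of the even reflection on R. *)
Definition cont_half f := continuous (fun s => f `|s|).

Definition deriv_half F f := forall t, 0 <= t -> is_derive t 1 F (f t).

Lemma cont_half_cst c : cont_half (cst c).
Proof. by move=> x; apply: cvg_cst. Qed.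

Lemma cont_halfD f g : cont_half f -> cont_half g ->
  cont_half (fun s => f s + g s).
Proof. by move=> cf cg x; apply: cvgD; [exact: cf|exact: cg]. Qed.

Lemma cont_halfN f : cont_half f -> cont_half (fun s => - f s).
Proof. by move=> cf x; apply: cvgN; exact: cf. Qed.

Lemma cont_halfM f g : cont_half f -> cont_half g ->
  cont_half (fun s => f s * g s).
Proof. by move=> cf cg x; apply: cvgM; [exact: cf|exact: cg]. Qed.

Lemma cont_half_sum n (f : 'I_n -> R -> R) : (forall i, cont_half (f i)) ->
  cont_half (fun s => \sum_i f i s).
Proof.
move=> cf x; apply: cvg_big => [|i _]; last exact: cf.
exact: add_continuous.
Qed.

Lemma continuous_cont_half f : continuous f -> cont_half f.
Proof.
by move=> cf x; apply: (continuous_comp (@norm_continuous _ _ _)); exact: cf.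
Qed.

Lemma deriv_half_cont F f : deriv_half F f -> cont_half F.
Proof.
move=> dF x; apply: (continuous_comp (@norm_continuous _ _ _)).
apply: differentiable_continuous; apply/derivable1_diffP.
by case: (dF `|x| (normr_ge0 x)).
Qed.

Lemma cont_half_within f t : cont_half f -> {within `[0, t], continuous f}.
Proof.
move=> cf; apply: (@subspace_eq_continuous _ _ _ (fun s => f `|s|)).
  by move=> x /[!inE]/=; rewrite in_itv/= => /andP[x0 _]; rewrite ger0_norm.
exact: continuous_subspaceT.
Qed.

Lemma integral_deriv_half F f t : 0 <= t -> cont_half f ->
  (forall s, 0 <= s <= t -> is_derive s 1 F (f s)) ->
  \int[lebesgue_measure]_(s in `[0, t]) f s = F t - F 0.
Proof.
rewrite le_eqVlt => /predU1P[<- _ _|t0 cf dF].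
  by rewrite set_itv1 Rintegral_set1 subrr.
have cF s : 0 <= s <= t -> F x @[x --> s] --> F s.
  move=> /dF[dF' _].
  exact/differentiable_continuous/derivable1_diffP.
rewrite /Rintegral (@continuous_FTC2 _ f F)//.
- exact: cont_half_within.
- split.
  + by move=> s /[!in_itv]/= /andP[/ltW s0 /ltW st]; case: (dF s); rewrite ?s0.
  + by apply/cvg_at_right_filter/cF; rewrite lexx ltW.
  + by apply/cvg_at_left_filter/cF; rewrite lexx ltW.
- move=> s /[!in_itv]/= /andP[/ltW s0 /ltW st]; rewrite derive1E.
  by case: (dF s); rewrite ?s0.
Qed.

Lemma primitive_half f : cont_half f -> exists2 F, F 0 = 0 & deriv_half F f.
Proof.
move=> cf; pose g s := f `|s|.
pose A x := \int[lebesgue_measure]_(s in `[-1, x]) g s.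
exists (A - cst (A 0)); first by rewrite /= /GRing.add/= /GRing.opp/= subrr.
move=> t t0; rewrite -[f t]subr0.
have tt1 : t < t + 1 by rewrite ltrDl.
have ig : lebesgue_measure.-integrable `[-1, (t + 1)] (EFin \o g).
  apply: continuous_compact_integrable; first exact: segment_compact.
  exact: continuous_subspaceT.
have [] := @continuous_FTC1_closed _ g (-1) t (t + 1) tt1 ig.
- by rewrite (lt_le_trans _ t0)// ltrN10.
- exact: cf.
- move=> dA eA; apply: is_deriveB; apply: DeriveDef => //.
  by rewrite -derive1E eA /g ger0_norm.
Qed.

Lemma deriv_half0_cst F : deriv_half F (cst 0) -> forall t, 0 <= t -> F t = F 0.
Proof.
move=> dF t t0.
have := integral_deriv_half t0 (@cont_half_cst 0) (F := F).
rewrite Rintegral_cst// mul0r => /(_ _)/esym/subr0_eq; apply.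
by move=> s /andP[s0 _]; exact: dF.
Qed.

End HalfLine.

Section Convolutions.
Variable R : realType.
Implicit Types (f g F G : R -> R) (t s : R).

Lemma eq_deriv_half F G f g : deriv_half F f -> deriv_half G g -> F 0 = G 0 ->
  (forall t, 0 <= t -> f t = g t) -> forall t, 0 <= t -> F t = G t.
Proof.
move=> dF dG FG0 fg t t0.
have : (F - G) t = (F - G) 0.
  apply: deriv_half0_cst => // s s0; apply: is_derive_eq.
    exact: is_deriveB (dF s s0) (dG s s0).
  by rewrite fg// subrr.
by rewrite /GRing.add/= /GRing.opp/= FG0 subrr => /subr0_eq.
Qed.

Lemma convol_reflect (k f : R -> R) H t : 0 <= t ->
  cont_half k -> cont_half f ->
  (forall s, 0 <= s <= t -> is_derive s 1 H (k s * f (t - s))) ->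
  convol k f t = H t - H 0.
Proof.
move=> t0 ck cf dH.
have {}dH s : 0 <= s <= t -> is_derive s 1 H (k s * f `|t - s|).
  by move=> st; have /andP[_ s1] := st; rewrite ger0_norm ?subr_ge0//; exact: dH.
rewrite -(integral_deriv_half t0 _ dH).
  apply: eq_Rintegral => s /[!inE]/=; rewrite in_itv/= => /andP[_ st].
  by rewrite ger0_norm// subr_ge0.
apply: cont_halfM => //; apply: (@continuous_cont_half _ (fun s => f `|t - s|)).
move=> x; apply: (@continuous_comp _ _ _ (fun s => t - s) (fun s => f `|s|)).
  by apply: cvgB; [exact: cvg_cst|exact: cvg_id].
exact: cf.
Qed.

Lemma is_derive_reflect F f t s : deriv_half F f -> s <= t ->
  is_derive s 1 (fun s => F (t - s)) (- f (t - s)).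
Proof.
move=> dF st; rewrite -mulrN1.
apply: (@is_derive1_comp _ F (fun s => t - s)); first by apply: dF; rewrite subr_ge0.
apply: is_derive_eq (is_deriveB (is_derive_cst t s 1) (is_derive_id s 1)) _.
by rewrite sub0r.
Qed.

Lemma convol_ell F f t : cont_half f -> deriv_half F f -> F 0 = 0 -> 0 <= t ->
  convol (@ell R) f t = F t.
Proof.
move=> cf dF F0 t0.
pose H s := - F (t - s).
rewrite (_ : convol _ _ _ = H t - H 0); last apply: (convol_reflect t0 _ cf).
- by rewrite /H subrr subr0 F0 oppr0 sub0r opprK.
- exact: cont_half_cst.
- move=> s /andP[s0 st]; rewrite /ell mul1r -[f _]opprK.
  exact/is_deriveN/is_derive_reflect.
Qed.

Lemma xiE t : 0 <= t -> xi t = t.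
Proof.
move=> t0; apply: (@convol_ell id) => //; first exact: cont_half_cst.
by move=> s _; exact: is_derive_id.
Qed.

Lemma convol_xi F G f t : cont_half f -> deriv_half G F -> deriv_half F f ->
  F 0 = 0 -> G 0 = 0 -> 0 <= t -> convol (@xi R) f t = G t.
Proof.
move=> cf dG dF F0 G0 t0.
have -> : convol (@xi R) f t = convol id f t.
  apply: eq_Rintegral => s /[!inE]/=; rewrite in_itv/= => /andP[s0 _].
  by rewrite xiE.
pose H s := - (s * F (t - s)) - G (t - s).
rewrite (_ : convol _ _ _ = H t - H 0); last apply: (convol_reflect t0 _ cf).
- by rewrite /H subrr subr0 F0 G0; ring.
- by apply: continuous_cont_half => x; exact: cvg_id.
- move=> s /andP[s0 st]; apply: is_derive_eq.
    apply: is_deriveB; last exact: (is_derive_reflect dG).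
    apply: is_deriveN; apply: is_deriveM.
    exact: (is_derive_reflect dF).
  by rewrite /GRing.scale/=; ring.
Qed.

(* zeta m and chi m are convertible to expdecay beta and expdecay beta'. *)
Definition expdecay (b : R) : R -> R := fun t => b^-1 * expR (- t / b).

Lemma is_derive_expRZ (c t : R) :
  is_derive t 1 (fun s => expR (s * c)) (c * expR (t * c)).
Proof.
rewrite mulrC; apply: (@is_derive1_comp _ expR (fun s => s * c)).
apply: is_derive_eq (is_deriveM (is_derive_id t 1) (is_derive_cst c t 1)) _.
by rewrite /GRing.scale/= mulr0 add0r mulr1.
Qed.

Lemma cont_half_expR (c : R) : cont_half (fun s => expR (s * c)).
Proof.
by apply: (@deriv_half_cont _ _ (fun t => c * expR (t * c))) => t _;
  exact: is_derive_expRZ.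
Qed.

Lemma convol_expdecay b F f t : cont_half f ->
  deriv_half F (fun s => expR (s / b) * f s) -> F 0 = 0 -> 0 <= t ->
  convol (expdecay b) f t = b^-1 * expR (- t / b) * F t.
Proof.
move=> cf dF F0 t0; set c := _ * expR _.
pose H s := - (c * F (t - s)).
rewrite (_ : convol _ _ _ = H t - H 0); last apply: (convol_reflect t0 _ cf).
- by rewrite /H subrr subr0 F0; ring.
- apply: cont_halfM; first exact: cont_half_cst.
  rewrite (_ : (fun s => _) = fun s => expR (s * - b^-1)); last first.
    by apply/funext => s; rewrite mulrN mulNr.
  exact: cont_half_expR.
- move=> s /andP[s0 st].
  have -> : expdecay b s * f (t - s) = c * (expR ((t - s) / b) * f (t - s)).
    rewrite mulrA /c /expdecay -[_ * _ * expR ((t - s) / b)]mulrA -expRD -mulrDl.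
    by rewrite addrA addNr sub0r.
  rewrite -[c * _]opprK -mulrN.
  exact: is_deriveN (is_deriveZ c (is_derive_reflect dF st)).
Qed.

End Convolutions.

Section TimeDerivative.
Variable R : realType.
Implicit Types (F : stfield R) (x : E3 R) (f G : R -> R) (s t : R).

Lemma timeIE t : timeI t <-> 0 <= t.
Proof. by rewrite /timeI/= in_itv/= andbT. Qed.

Lemma dt_filter_proper t : 0 <= t ->
  ProperFilter (within [set h | timeI (t + h)] (0 : R)^').
Proof.
move=> t0; apply: Build_ProperFilter_ex => P [/= e e0 eP].
have e20 : 0 < e / 2 by rewrite divr_gt0.
exists (e / 2); apply: eP => /=.
- by rewrite sub0r normrN gtr0_norm// ltr_pdivrMr// ltr_pMr// ltr1n.
- by rewrite gt_eqF.
- by apply/timeIE; rewrite addr_ge0// ltW.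
Qed.

Lemma is_derive_of_cvg f t v :
  h^-1 * (f (t + h) - f t) @[h --> 0^'] --> v -> is_derive t 1 f v.
Proof.
move=> fv; have {}fv : h^-1 *: ((f \o shift t) (h *: 1) - f t) @[h --> 0^'] --> v.
  apply: cvg_trans fv; apply: near_eq_cvg; near=> h.
  by rewrite /GRing.scale/= mulr1 [h + t]addrC.
apply: DeriveDef; first by apply/cvg_ex; exists v.
exact/cvg_lim.
Unshelve. all: by end_near. Qed.

Lemma dt_of_deriv_half F x G f t : deriv_half G f ->
  (forall s, 0 <= s -> F x s = G s) -> 0 <= t -> dt F x t = f t.
Proof.
move=> dG FG t0; have [/= dGt vG] := dG t t0.
have FF := dt_filter_proper t0.
apply/cvg_lim => //; rewrite -vG.
have /cvg_within_filter : h^-1 *: ((G \o shift t) (h *: 1) - G t)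
    @[h --> 0^'] --> 'D_1 G t  by [].
move=> /(_ [set h | timeI (t + h)]); apply: cvg_trans.
apply: near_eq_cvg; rewrite near_withinE; near=> h => /timeIE th.
by rewrite /= FG// FG// /GRing.scale/= mulr1 [h + t]addrC.
Unshelve. all: by end_near. Qed.

(* The extension by odd reflection about (0, F x 0) is differentiable on both
   sides of 0. *)
Lemma deriv_half_of_dt F x : (forall t, timeI t -> derivable_t F x t) ->
  exists2 G, forall s, 0 <= s -> F x s = G s & deriv_half G (dt F x).
Proof.
move=> dF; pose G s := F x 0 + Num.sg s * (F x `|s| - F x 0).
have GE s : 0 <= s -> F x s = G s.
  rewrite le_eqVlt => /predU1P[<-|s0]; rewrite /G.
    by rewrite sgr0 mul0r addr0.
  by rewrite gtr0_sg// gtr0_norm// mul1r addrC subrK.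
exists G => // t t0; apply: is_derive_of_cvg.
have {}dF := dF t (proj2 (timeIE t) t0).
move: t0; rewrite le_eqVlt => /predU1P[t0|t0]; last first.
  apply: cvg_trans dF => /=.
  have tn : \forall h \near (0 : R)^', 0 < t + h.
    apply: nbhs_dnbhs; exists t => //= h /=; rewrite sub0r normrN => /ltr_normlP[+ _].
    by rewrite ltrNl -subr_gt0 opprK addrC.
  move=> A [/= e e0 eA]; case: tn => /= e' e0' tn.
  exists (Num.min e e'); first by rewrite /= lt_min e0.
  move=> h /=; rewrite lt_min => /andP[he he'] h0.
  have th := tn h he' h0.
  rewrite -!GE ?ltW//; apply: eA => //; exact/timeIE/ltW.
rewrite -t0 in dF *.
have -> : (fun h => h^-1 * (G (0 + h) - G 0)) =
    (fun h => h^-1 * (F x (0 + h) - F x 0)) \o Num.norm.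
  apply/funext => h; rewrite /= !add0r -(GE 0)// /G addrAC subrr add0r mulrA.
  congr (_ * _); case: (ltrgt0P h) => [h0|h0|->].
  - by rewrite gtr0_sg// mulr1.
  - by rewrite ltr0_sg// mulrN1 invrN.
  - by rewrite sgr0 mulr0 invr0.
apply: cvg_comp dF => A [/= e e0 eA].
exists e => // h /=; rewrite sub0r normrN => he h0; apply: eA => /=.
- by rewrite sub0r normrN normr_id.
- by rewrite normr_eq0.
- by apply/timeIE; rewrite add0r.
Qed.

Lemma deriv_half_eq (F G f g : R -> R) : deriv_half F f -> deriv_half G g ->
  (forall t, 0 <= t -> F t = G t) -> forall t, 0 <= t -> f t = g t.
Proof.
move=> dF dG FG t t0.
rewrite -(@dt_of_deriv_half (fun=> F) 0 _ _ t dF)//.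
exact: (@dt_of_deriv_half (fun=> F) 0 _ _ t dG).
Qed.

Lemma cont_half_of_field (D : set (E3 R)) F x : D x -> continuous_on D F ->
  cont_half (F x).
Proof.
move=> Dx /subspace_continuousP cF s.
apply: (@cvg_comp _ _ _ (fun s : R => (x, `|s|)) (fun z => F z.1 z.2) _
  (within (D `*` @timeI R) (nbhs (x, `|s|)))).
  move=> A; rewrite {1}/within /= => DA.
  have : (fun s : R => (x, `|s|)) @ nbhs s --> (x, `|s|).
    exact: (cvg_pair (cvg_cst x) (@norm_continuous _ _ s)).
  move=> /(_ _ DA); apply: (@filterS _ (nbhs s) _
    (fun r => (D `*` @timeI R) (x, `|r|) -> A (x, `|r|))) => r; apply.
  by split; [exact: Dx|exact: (proj2 (timeIE _) (normr_ge0 _))].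
by apply: (cF (x, `|s|)); split; [exact: Dx|exact: (proj2 (timeIE _) (normr_ge0 _))].
Qed.

End TimeDerivative.

Section ConvolutionEquations.
Variable R : realType.
Implicit Types (f g U u w : R -> R) (t a b : R).

(* Unlike in deriv_half, the derivative of U at 0 is one-sided here. *)
Definition half_deriv U u :=
  exists2 G, forall s, 0 <= s -> U s = G s & deriv_half G u.

Lemma convol_expdecay_eq a b c f U u : b != 0 -> cont_half f ->
  half_deriv U u -> U 0 = c ->
  (forall t, 0 <= t ->
     convol (expdecay b) f t - a * U t + a * c * expR (- t / b) = 0) <->
  (forall t, 0 <= t -> f t = a * (U t + b * u t)).
Proof.
move=> b0 cf [G UG dG] Uc.
have cg : cont_half (fun s => expR (s / b) * f s).
  by apply: cont_halfM => //; exact: cont_half_expR.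
have [K K0 dK] := primitive_half cg.
pose L s := a * b * (G s * expR (s / b) - c).
have dL : deriv_half L (fun s => expR (s / b) * (a * (G s + b * u s))).
  move=> s s0; have dGe := is_deriveM (dG s s0) (is_derive_expRZ b^-1 s).
  apply: is_derive_eq (is_deriveZ (a * b) (is_deriveB dGe (is_derive_cst c s 1))) _.
  by rewrite subr0 /GRing.scale/=; field.
have L0 : L 0 = 0 by rewrite /L mul0r expR0 mulr1 -UG// Uc subrr mulr0.
have eqE t : 0 <= t ->
    convol (expdecay b) f t - a * U t + a * c * expR (- t / b) =
    b^-1 * expR (- t / b) * (K t - L t).
  move=> t0; rewrite (convol_expdecay cf dK)// /L UG//.
  have e1 : expR (- t / b) * expR (t / b) = 1.
    by rewrite -expRD mulNr addNr expR0.
  rewrite [RHS]mulrBr -addrA; congr (_ + _).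
  rewrite (_ : b^-1 * _ * _ =
      a * (expR (- t / b) * expR (t / b) * G t - expR (- t / b) * c)).
    by rewrite e1; ring.
  by field.
split=> [H t t0|H t t0].
  have KL s : 0 <= s -> K s = L s.
    move=> s0; have /eqP := H s s0; rewrite eqE// mulf_eq0 mulf_eq0 invr_eq0.
    by rewrite (negbTE b0) gt_eqF ?expR_gt0//= subr_eq0 => /eqP.
  have := deriv_half_eq dK dL KL t0; rewrite UG//.
  by apply: mulfI; rewrite gt_eqF// expR_gt0.
rewrite eqE//.
suff -> : K t = L t by rewrite subrr mulr0.
apply: (eq_deriv_half dK dL) t0; first by rewrite K0 L0.
by move=> s s0; rewrite H// UG.
Qed.

Lemma half_deriv0 : half_deriv (cst 0) (cst 0).
Proof. by exists (cst 0) => // s s0; exact: is_derive_cst. Qed.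

Lemma convol_expdecay_eq0 b f : b != 0 -> cont_half f ->
  (forall t, 0 <= t -> convol (expdecay b) f t = 0) <->
  (forall t, 0 <= t -> f t = 0).
Proof.
move=> b0 cf; have := @convol_expdecay_eq 0 b 0 f _ _ b0 cf half_deriv0 erefl.
move=> [H1 H2]; split=> H t t0.
  rewrite H1 ?mul0r// => s s0.
  by rewrite H// !mul0r subr0 addr0.
have := H2 _ t t0; rewrite !mul0r subr0 addr0; apply => s s0.
by rewrite H// mul0r.
Qed.

Lemma convol_ell_eq0 f : cont_half f ->
  (forall t, 0 <= t -> convol (@ell R) f t = 0) <->
  (forall t, 0 <= t -> f t = 0).
Proof.
move=> cf; have [F F0 dF] := primitive_half cf.
have d0 : deriv_half (cst 0) (cst 0 : R -> R) by move=> s _; exact: is_derive_cst.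
split=> H t t0.
  by apply: (deriv_half_eq dF d0) t0 => s s0; rewrite -(convol_ell cf dF)// H.
by rewrite (convol_ell cf dF)//; apply: (eq_deriv_half dF d0) t0.
Qed.

Lemma convol_ell_balance a c f g U u : a != 0 -> cont_half f -> cont_half g ->
  half_deriv U u ->
  (forall t, 0 <= t ->
     a * U t + convol (@ell R) f t - (a * c + convol (@ell R) g t) = 0) <->
  U 0 = c /\ (forall t, 0 <= t -> a * u t + f t - g t = 0).
Proof.
move=> a0 cf cg [V UV dV].
have [F F0 dF] := primitive_half cf; have [G G0 dG] := primitive_half cg.
pose W t := a * V t + F t - (a * c + G t).
have dW : deriv_half W (fun t => a * u t + f t - g t).
  move=> t t0; apply: is_derive_eq.
    apply: is_deriveB.
      exact: is_deriveD (is_deriveZ a (dV t t0)) (dF t t0).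
    exact: is_deriveD (is_derive_cst (a * c) t 1) (dG t t0).
  by rewrite add0r.
have d0 : deriv_half (cst 0) (cst 0 : R -> R) by move=> s _; exact: is_derive_cst.
have WE t : 0 <= t ->
    a * U t + convol (@ell R) f t - (a * c + convol (@ell R) g t) = W t.
  by move=> t0; rewrite (convol_ell cf dF)// (convol_ell cg dG)// UV.
have W0 : W 0 = a * (U 0 - c) by rewrite /W UV// F0 G0; ring.
split=> [H|[Uc H] t t0].
  split=> [|t t0].
    have /eqP := H 0 (lexx 0).
    by rewrite WE// W0 mulf_eq0 (negbTE a0)/= subr_eq0 => /eqP.
  by apply: (deriv_half_eq dW d0) t0 => s s0; rewrite -WE// H.
rewrite WE//; apply: (eq_deriv_half dW d0) t0 => //.
by rewrite W0 Uc subrr mulr0.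
Qed.

Lemma convol_xi_eq0 f : cont_half f ->
  (forall t, 0 <= t -> convol (@xi R) f t = 0) <->
  (forall t, 0 <= t -> f t = 0).
Proof.
move=> cf; have [F F0 dF] := primitive_half cf.
have cF := deriv_half_cont dF.
have [G G0 dG] := primitive_half cF.
have E t : 0 <= t -> convol (@xi R) f t = convol (@ell R) F t.
  by move=> t0; rewrite (convol_xi cf dG dF)// (convol_ell cF dG).
have [e1 e2] := convol_ell_eq0 cF; have [e3 e4] := convol_ell_eq0 cf.
split=> H t t0.
  apply: e3 t0 => s s0; rewrite (convol_ell cf dF)//; apply: e1 s0 => r r0.
  by rewrite -E// H.
rewrite E//; apply: e2 t0 => s s0; rewrite -(convol_ell cf dF)//.
exact: e4.
Qed.

Lemma convol_xi_balance a c v f g U u w : a != 0 ->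
  cont_half f -> cont_half g -> half_deriv U u -> half_deriv u w ->
  (forall t, 0 <= t -> convol (@xi R) f t - a * U t
     + (a * convol (@xi R) g t + a * v * t + a * c) = 0) <->
  [/\ U 0 = c, u 0 = v & forall t, 0 <= t -> f t + a * g t = a * w t].
Proof.
move=> a0 cf cg [V UV dV] [V' uV' dV'].
have [F F0 dF] := primitive_half cf; have [G G0 dG] := primitive_half cg.
have [FF FF0 dFF] := primitive_half (deriv_half_cont dF).
have [GG GG0 dGG] := primitive_half (deriv_half_cont dG).
pose W1 t := F t + a * G t + a * v - a * V' t.
pose W t := FF t - a * V t + (a * GG t + a * v * t + a * c).
have dW : deriv_half W W1.
  move=> t t0; apply: is_derive_eq.
    exact: is_deriveD (is_deriveB (dFF t t0) (is_deriveZ a (dV t t0)))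
      (is_deriveD (is_deriveD (is_deriveZ a (dGG t t0))
        (is_deriveZ (a * v) (is_derive_id t 1))) (is_derive_cst (a * c) t 1)).
  by rewrite /W1 -uV'// /GRing.scale/=; ring.
have dW1 : deriv_half W1 (fun t => f t + a * g t - a * w t).
  move=> t t0; apply: is_derive_eq.
    exact: is_deriveB (is_deriveD (is_deriveD (dF t t0) (is_deriveZ a (dG t t0)))
      (is_derive_cst (a * v) t 1)) (is_deriveZ a (dV' t t0)).
  by rewrite addr0.
have d0 : deriv_half (cst 0) (cst 0 : R -> R) by move=> s _; exact: is_derive_cst.
have WE t : 0 <= t -> convol (@xi R) f t - a * U t
     + (a * convol (@xi R) g t + a * v * t + a * c) = W t.
  by move=> t0; rewrite (convol_xi cf dFF dF)// (convol_xi cg dGG dG)// UV.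
have W0 : W 0 = a * (c - U 0) by rewrite /W UV// FF0 GG0; ring.
have W10 : W1 0 = a * (v - u 0) by rewrite /W1 uV'// F0 G0; ring.
split=> [H|[Uc uv H] t t0].
  have W1t t : 0 <= t -> W1 t = 0.
    by move=> t0; apply: (deriv_half_eq dW d0) t0 => s s0; rewrite -WE// H.
  split=> [||t t0].
  - have /eqP := H 0 (lexx 0).
    by rewrite WE// W0 mulf_eq0 (negbTE a0)/= subr_eq0 => /eqP.
  - have /eqP := W1t 0 (lexx 0).
    by rewrite W10 mulf_eq0 (negbTE a0)/= subr_eq0 => /eqP.
  - exact/subr0_eq/(deriv_half_eq dW1 d0 W1t).
rewrite WE//; apply: (eq_deriv_half dW d0) t0; first by rewrite W0 Uc subrr mulr0.
apply: (eq_deriv_half dW1 d0); first by rewrite W10 uv subrr mulr0.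
by move=> s s0; rewrite H// subrr.
Qed.

End ConvolutionEquations.

Section Reduction.
Variables (R : realType) (B : set (E3 R)) (m : material R) (d : data R).
Variables (p : process R) (S Sigma : nat -> set (E3 R)).
Hypotheses (hm : material_assumptions m) (hd : continuous_data B S Sigma d).
Hypothesis hp : admissible_regularity B p.

Lemma classC_cont_half M N F s x : classC B M N F -> (size s <= M)%N ->
  closure B x -> cont_half (foldr (dx B) F s x).
Proof.
move=> [_ _ cF] sM Bx; exact: cont_half_of_field Bx (cF s 0%N sM isT).
Qed.

Lemma classC_half_deriv M N F k x : classC B M N F -> (k < N)%N ->
  closure B x -> half_deriv (iter k (@dt R) F x) (dt (iter k (@dt R) F) x).
Proof.
by move=> [dF _ _] kN Bx; apply: deriv_half_of_dt => t; exact: dF.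
Qed.

Section AtPoint.
Variables (x : E3 R) (Bx : closure B x).

Let cont0 M N F (cF : classC B M N F) : cont_half (F x) :=
  @classC_cont_half M N F [::] x cF isT Bx.

Lemma stress_div_cont i : cont_half (stress_div B p i x).
Proof.
apply: cont_halfD; last apply: cont_halfN.
  apply: cont_half_sum => j.
  exact: (classC_cont_half (s := [:: j]) (tau_reg hp j i)).
apply: cont_half_sum => k; apply: cont_half_sum => j.
exact: (classC_cont_half (s := [:: j; k]) (mu_reg hp k j i)).
Qed.

Lemma electric_div_cont : cont_half (electric_div B p x).
Proof.
apply: cont_halfD; last apply: cont_halfN.
  apply: cont_half_sum => i.
  exact: (classC_cont_half (s := [:: i]) (sigma_reg hp i)).
apply: cont_half_sum => j; apply: cont_half_sum => i.
exact: (classC_cont_half (s := [:: i; j]) (Q_reg hp j i)).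
Qed.

Lemma heat_div_cont : cont_half (heat_div B p x).
Proof.
apply: cont_half_sum => i.
exact: (classC_cont_half (s := [:: i]) (q_reg hp i)).
Qed.

Let contZ (c : R) (f : R -> R) : cont_half f -> cont_half (fun t => c * f t).
Proof. by move=> cf; apply: cont_halfM cf; exact: cont_half_cst. Qed.

Let cont_sum2 (a : 'I_3 -> 'I_3 -> R) (F : 'I_3 -> 'I_3 -> stfield R) :
  (forall k l, cont_half (F k l x)) ->
  cont_half (fun t => \sum_k \sum_l a k l * F k l x t).
Proof.
move=> cF; apply: cont_half_sum => k; apply: cont_half_sum => l.
exact: contZ.
Qed.

Lemma tau_hat_cont i j : cont_half (tau_hat m p i j x).
Proof.
apply: cont_halfD; apply: cont_sum2 => k l.
  exact: cont0 (e_reg hp k l).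
exact: cont0 (V_reg hp k l).
Qed.

Lemma mu_hat_cont i j k : cont_half (mu_hat m p i j k x).
Proof.
apply: cont_halfD.
  apply: cont_half_sum => l; apply: cont_sum2 => h r.
  exact: cont0 (kappa_reg hp l h r).
by apply: cont_half_sum => l; apply: contZ; exact: cont0 (E_reg hp l).
Qed.

Lemma sigma_hat_cont i : cont_half (sigma_hat m p i x).
Proof.
apply: cont_halfN; apply: cont_halfD.
  apply: cont_half_sum => j; apply: cont_sum2 => k l.
  exact: cont0 (kappa_reg hp j k l).
by apply: cont_half_sum => j; apply: contZ; exact: cont0 (E_reg hp j).
Qed.

Lemma Q_hat_cont i j : cont_half (Q_hat m p i j x).
Proof.
apply: cont_halfN; apply: cont_halfD; apply: cont_sum2 => k l.
  exact: cont0 (e_reg hp k l).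
exact: cont0 (V_reg hp k l).
Qed.

Lemma eta_hat_cont : cont_half (eta_hat m p x).
Proof.
apply: contZ; apply: cont_halfD; apply: cont_sum2 => k l.
  exact: cont0 (e_reg hp k l).
exact: cont0 (V_reg hp k l).
Qed.

Lemma q_hat_cont i : cont_half (q_hat m p i x).
Proof.
apply: cont_halfN; apply: contZ; apply: cont_half_sum => j; apply: contZ.
exact: cont0 (betav_reg hp j).
Qed.

Let contB (f g : R -> R) : cont_half f -> cont_half g -> cont_half (fun t => f t - g t).
Proof. by move=> cf cg; apply: cont_halfD => //; exact: cont_halfN. Qed.

Let theta_deriv : half_deriv (p.(theta) x) (dt p.(theta) x).
Proof. exact: (classC_half_deriv (k := 0) (theta_reg hp)). Qed.

Let beta0 : m.(beta) != 0. Proof. exact: beta_neq0 hm. Qed.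

Lemma momentum_equiv i :
  (forall t, 0 <= t -> convol (@xi R) (stress_div B p i x) t
    - m.(rho) * p.(u) i x t + calF m d i x t = 0) <->
  [/\ p.(u) i x 0 = d.(u0) i x, dt (p.(u) i) x 0 = d.(v0) i x
    & forall t, 0 <= t -> stress_div B p i x t + m.(rho) * d.(f) i x t
        = m.(rho) * dt (dt (p.(u) i)) x t].
Proof.
apply: convol_xi_balance.
- by rewrite gt_eqF// rho_pos.
- exact: stress_div_cont.
- exact: (cont_half_of_field Bx (@f_cont _ _ _ _ _ hd i)).
- exact: (classC_half_deriv (k := 0) (u_reg hp i)).
- exact: (classC_half_deriv (k := 1) (u_reg hp i)).
Qed.

Lemma electric_equiv :
  (forall t, 0 <= t ->
    convol (@xi R) (fun s => electric_div B p x s - d.(g) x s) t = 0) <->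
  (forall t, 0 <= t -> electric_div B p x t = d.(g) x t).
Proof.
rewrite convol_xi_eq0; last first.
  by apply: contB electric_div_cont _;
    exact: (cont_half_of_field Bx (@g_cont _ _ _ _ _ hd)).
by split=> H t t0; [exact/subr0_eq/H|rewrite H// subrr].
Qed.

Lemma energy_equiv :
  (forall t, 0 <= t -> m.(rho) * m.(T0) * p.(eta) x t
     + convol (@ell R) (heat_div B p x) t - calH m d x t = 0) <->
  p.(eta) x 0 = d.(eta0) x /\
  (forall t, 0 <= t -> m.(rho) * m.(T0) * dt p.(eta) x t + heat_div B p x t
     - m.(rho) * d.(h) x t = 0).
Proof.
apply: convol_ell_balance.
- by rewrite mulf_neq0 ?gt_eqF ?rho_pos ?T0_pos.
- exact: heat_div_cont.
- exact/contZ/(cont_half_of_field Bx (@h_cont _ _ _ _ _ hd)).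
- exact: (classC_half_deriv (k := 0) (eta_reg hp)).
Qed.

Lemma tau_equiv i j : p.(theta) x 0 = d.(theta0) x ->
  (forall t, 0 <= t ->
    convol (zeta m) (fun s => p.(tau) i j x s - tau_hat m p i j x s) t
    - m.(a14) i j * p.(theta) x t + calL m d i j x t = 0) <->
  (forall t, 0 <= t -> p.(tau) i j x t = tau_hat m p i j x t
    + m.(a14) i j * (p.(theta) x t + m.(beta) * dt p.(theta) x t)).
Proof.
move=> th0.
have [H1 H2] := @convol_expdecay_eq _ (m.(a14) i j) _ _
  (fun s => p.(tau) i j x s - tau_hat m p i j x s) _ _ beta0
  (contB (cont0 (tau_reg hp i j)) (@tau_hat_cont i j)) theta_deriv th0.
split=> H t t0; first by have := H1 H t t0; lra.
by apply: H2 t0 => s s0; rewrite H//; lra.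
Qed.

Lemma mu_equiv i j k :
  (forall t, 0 <= t ->
    convol (zeta m) (fun s => p.(mu) i j k x s - mu_hat m p i j k x s) t = 0)
  <-> (forall t, 0 <= t -> p.(mu) i j k x t = mu_hat m p i j k x t).
Proof.
have [H1 H2] := convol_expdecay_eq0 beta0
  (contB (cont0 (mu_reg hp i j k)) (@mu_hat_cont i j k)).
split=> H t t0; first by apply/subr0_eq; exact: H1 H t t0.
by apply: H2 t0 => s s0; rewrite H// subrr.
Qed.

Lemma sigma_equiv i :
  (forall t, 0 <= t ->
    - convol (zeta m) (fun s => p.(sigma) i x s - sigma_hat m p i x s) t = 0)
  <-> (forall t, 0 <= t -> p.(sigma) i x t = sigma_hat m p i x t).
Proof.
have [H1 H2] := convol_expdecay_eq0 beta0
  (contB (cont0 (sigma_reg hp i)) (@sigma_hat_cont i)).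
split=> H t t0.
  apply/subr0_eq; apply: H1 t0 => s s0; apply/eqP.
  by rewrite -oppr_eq0; apply/eqP/H.
by rewrite H2 ?oppr0// => s s0; rewrite H// subrr.
Qed.

Lemma Q_equiv i j : p.(theta) x 0 = d.(theta0) x ->
  (forall t, 0 <= t ->
    - convol (zeta m) (fun s => p.(Q) i j x s - Q_hat m p i j x s) t
    - m.(a47) i j * p.(theta) x t + calM m d i j x t = 0) <->
  (forall t, 0 <= t -> - p.(Q) i j x t = - Q_hat m p i j x t
    + m.(a47) i j * (p.(theta) x t + m.(beta) * dt p.(theta) x t)).
Proof.
move=> th0.
have [H1 H2] := @convol_expdecay_eq _ (- m.(a47) i j) _ _
  (fun s => p.(Q) i j x s - Q_hat m p i j x s) _ _ beta0
  (contB (cont0 (Q_reg hp i j)) (@Q_hat_cont i j)) theta_deriv th0.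
split=> H t t0.
  suff : p.(Q) i j x t - Q_hat m p i j x t
    = - m.(a47) i j * (p.(theta) x t + m.(beta) * dt p.(theta) x t) by lra.
  apply: H1 t0 => s s0; have := H s s0; rewrite /calM => E.
  apply: oppr_inj; rewrite oppr0 -[RHS]E /zeta /expdecay; ring.
have : - m.(a47) i j * p.(theta) x t = - (m.(a47) i j * p.(theta) x t).
  by rewrite mulNr.
have := H2 _ t t0; rewrite /calM => E _.
apply: oppr_inj; rewrite oppr0 -[RHS]E; last first.
  by move=> s s0; have := H s s0; lra.
by rewrite /zeta /expdecay; ring.
Qed.

Lemma eta_equiv : p.(theta) x 0 = d.(theta0) x ->
  (forall t, 0 <= t ->
    - convol (chi m)
        (fun s => m.(rho) * p.(eta) x s - m.(rho) * eta_hat m p x s) t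
    - m.(cth) * p.(theta) x t + calR m d x t = 0) <->
  (forall t, 0 <= t -> - (m.(rho) * p.(eta) x t) =
    - (m.(rho) * eta_hat m p x t)
    + m.(cth) * (p.(theta) x t + beta' m * dt p.(theta) x t)).
Proof.
move=> th0.
have [H1 H2] := @convol_expdecay_eq _ (- m.(cth)) _ _
  (fun s => m.(rho) * p.(eta) x s - m.(rho) * eta_hat m p x s) _ _
  (beta'_neq0 hm)
  (contB (@contZ _ _ (cont0 (eta_reg hp))) (@contZ _ _ eta_hat_cont)) theta_deriv th0.
split=> H t t0.
  suff : m.(rho) * p.(eta) x t - m.(rho) * eta_hat m p x t
    = - m.(cth) * (p.(theta) x t + beta' m * dt p.(theta) x t) by lra.
  apply: H1 t0 => s s0; have := H s s0; rewrite /calR => E.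
  apply: oppr_inj; rewrite oppr0 -[RHS]E /chi /expdecay; ring.
have := H2 _ t t0; rewrite /calR => E.
apply: oppr_inj; rewrite oppr0 -[RHS]E; last first.
  by move=> s s0; have := H s s0; lra.
by rewrite /chi /expdecay; ring.
Qed.

Lemma q_equiv i :
  (forall t, 0 <= t -> - (m.(T0)^-1
     * convol (@ell R) (fun s => p.(q) i x s - q_hat m p i x s) t) = 0)
  <-> (forall t, 0 <= t -> p.(q) i x t = q_hat m p i x t).
Proof.
have T0n : m.(T0) != 0 by rewrite gt_eqF// T0_pos.
have [H1 H2] := convol_ell_eq0 (contB (cont0 (q_reg hp i)) (@q_hat_cont i)).
split=> H t t0.
  apply/subr0_eq; apply: H1 t0 => s s0; have /eqP := H s s0.
  by rewrite oppr_eq0 mulf_eq0 invr_eq0 (negbTE T0n)/= => /eqP.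
by rewrite H2 ?mulr0 ?oppr0// => s s0; rewrite H// subrr.
Qed.

End AtPoint.
End Reduction.

Section ConstitutiveForms.
Variables (R : realType) (m : material R) (p : process R).
Hypothesis hm : material_assumptions m.

Lemma rho_eta_hat x t : - (m.(rho) * eta_hat m p x t) =
  \sum_i \sum_j m.(a14) i j * p.(e) i j x t
  + \sum_i \sum_j m.(a47) i j * p.(V) i j x t.
Proof. by rewrite /eta_hat mulNr mulrN opprK mulVKf// gt_eqF// rho_pos. Qed.

Lemma q_hat_eq i x t : p.(q) i x t = q_hat m p i x t <->
  - (m.(T0)^-1 * p.(q) i x t) = \sum_j m.(kth) i j * p.(betav) j x t.
Proof.
have T0n : m.(T0) != 0 by rewrite gt_eqF// T0_pos.
rewrite /q_hat; split=> [->|<-]; first by rewrite mulrN opprK mulKf.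
by rewrite mulrN opprK mulVKf.
Qed.

Lemma sigma_hat_eq i x t : p.(sigma) i x t = sigma_hat m p i x t <->
  - p.(sigma) i x t = \sum_j \sum_k \sum_l m.(a23) j k l i * p.(kappa) j k l x t
    + \sum_j m.(a33) i j * p.(E) j x t.
Proof. by rewrite /sigma_hat; split=> [->|<-]; rewrite opprK. Qed.

End ConstitutiveForms.

Theorem theorem2 (R : realType)
    (B : set (E3 R)) (n : E3 R -> E3 R)
    (S Sigma : nat -> set (E3 R))
    (m : material R) (d : data R) (p : process R)
    (hB : bounded_smooth_region B)
    (hn : outward_unit_normal B n)
    (hS : boundary_partition B S Sigma)
    (hm : material_assumptions m)
    (hd : continuous_data B S Sigma d)
    (hp : admissible B p) :
  solution B n S Sigma m d p <->
  [/\ geometric_equations B p,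
      convolution_equations B m d p
    & boundary_conditions B n S Sigma d p].
Proof.
have hr := proj1 hp.
have I0 t : 0 <= t -> @timeI R t by move/timeIE.
split=> [[_ bal geo cons ini bc]|[geo [cmom cel cen ctau cmu csig cQ ceta cq] bc]].
  have th0 x : closure B x -> p.(theta) x 0 = d.(theta0) x by move=> /ini[].
  split=> //; split=> x t Bx /timeIE.
  - move=> t0 i; apply: (proj2 (momentum_equiv hm hd hr Bx i)) t0.
    have [u0 v0 _ _] := ini x Bx; split=> // s /I0 s0.
    by have [] := bal x s Bx s0.
  - apply: (proj2 (electric_equiv hd hr Bx)) => s /I0 s0.
    by have [] := bal x s Bx s0.
  - apply: (proj2 (energy_equiv hm hd hr Bx)).
    have [_ _ _ eta0] := ini x Bx; split=> // s /I0 s0.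
    by have [] := bal x s Bx s0.
  - move=> t0 i j; apply: (proj2 (tau_equiv hm hr Bx i j (th0 x Bx))) t0.
    by move=> s /I0 s0; have [[]] := cons x s Bx s0.
  - move=> t0 i j k; apply: (proj2 (mu_equiv hm hr Bx i j k)) t0.
    by move=> s /I0 s0; have [[]] := cons x s Bx s0.
  - move=> t0 i; apply: (proj2 (sigma_equiv hm hr Bx i)) t0.
    move=> s /I0 s0; have [[_ _ H _ _ _]] := cons x s Bx s0.
    exact/sigma_hat_eq.
  - move=> t0 i j; apply: (proj2 (Q_equiv hm hr Bx i j (th0 x Bx))) t0.
    move=> s /I0 s0; have [_ H _ _] := cons x s Bx s0.
    by rewrite H /Q_hat opprK.
  - apply: (proj2 (eta_equiv hm hr Bx (th0 x Bx))).
    move=> s /I0 s0; have [_ _ H _] := cons x s Bx s0.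
    by rewrite H rho_eta_hat.
  - move=> t0 i; apply: (proj2 (q_equiv hm hr Bx i)) t0.
    move=> s /I0 s0; have [_ _ _ H] := cons x s Bx s0.
    exact/q_hat_eq.
have th0 x : closure B x -> p.(theta) x 0 = d.(theta0) x.
  move=> Bx; have /eqP := ceta x 0 Bx (I0 0 (lexx 0)).
  rewrite /calR /convol set_itv1 Rintegral_set1 !oppr0 add0r mul0r expR0 mulr1.
  rewrite addrC subr_eq0 => /eqP /mulfI e0; apply/esym/e0; exact: cth_neq0 hm.
have mom x (Bx : closure B x) i :=
  proj1 (momentum_equiv hm hd hr Bx i) (fun t t0 => cmom x t Bx (I0 t t0) i).
have en x (Bx : closure B x) :=
  proj1 (energy_equiv hm hd hr Bx) (fun t t0 => cen x t Bx (I0 t t0)).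
split=> //.
- move=> x t Bx /timeIE t0; split.
  + by move=> i; have [_ _] := mom x Bx i; apply.
  + by apply: (proj1 (electric_equiv hd hr Bx)) t0 => s /I0; exact: cel.
  + by have [_] := en x Bx; apply.
- move=> x t Bx /timeIE t0 /=; split; first split.
  + move=> i j; apply: (proj1 (tau_equiv hm hr Bx i j (th0 x Bx))) t0.
    by move=> s /I0 s0; exact: ctau.
  + move=> i j k; apply: (proj1 (mu_equiv hm hr Bx i j k)) t0.
    by move=> s /I0 s0; exact: cmu.
  + move=> i; apply/sigma_hat_eq; apply: (proj1 (sigma_equiv hm hr Bx i)) t0.
    by move=> s /I0 s0; exact: csig.
  + move=> i j; rewrite (proj1 (Q_equiv hm hr Bx i j (th0 x Bx)))//.
      by rewrite /Q_hat opprK.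
    by move=> s /I0 s0; exact: cQ.
  + rewrite (proj1 (eta_equiv hm hr Bx (th0 x Bx)))//; first by rewrite rho_eta_hat.
    by move=> s /I0 s0; exact: ceta.
  + move=> i; apply/(q_hat_eq _ hm); apply: (proj1 (q_equiv hm hr Bx i)) t0.
    by move=> s /I0 s0; exact: cq.
- move=> x Bx; split.
  + by move=> i; have [] := mom x Bx i.
  + by move=> i; have [] := mom x Bx i.
  + exact: th0.
  + by have [] := en x Bx.
Qed.
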